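(* For every integer $k\ge 1$, $R(K_{9k+7},\mathbb{Z}_3)=9k+10$.
   Context: $K_m$ denotes the complete graph on $m$ vertices. For a finite simple graph $H$ whose number of edges $e(H)$ is divisible by $3$, the zero-sum Ramsey number $R(H,\mathbb{Z}_3)$ is the least integer $N$ such that every edge labeling $w\colon E(K_N)\to\mathbb{Z}_3$ admits a copy $H'$ of $H$ in $K_N$ (a not necessarily induced subgraph isomorphic to $H$) with $\sum_{e\in E(H')}w(e)=0$ in $\mathbb{Z}_3$. For $H=K_n$ the divisibility condition $3\mid\binom n2$ is equivalent to $n\equiv 0,1\pmod 3$. *)

(* Defs.v *)
From mathcomp Require Import all_boot all_algebra.

Set Implicit Arguments.
Unset Strict Implicit.
Unset Printing Implicit Defensive.

Import GRing.Theory.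
Local Open Scope ring_scope.

Record sgraph := SGraph {
  vertex :> finType;
  edges : {set {set vertex}};
  edges_card2 : forall e, e \in edges -> #|e| = 2%N }.

Lemma complete_card2 (m : nat) (e : {set 'I_m}) :
  e \in [set e : {set 'I_m} | #|e| == 2%N] -> #|e| = 2%N.
Proof. by rewrite inE => /eqP. Qed.

Definition complete (m : nat) : sgraph := SGraph (@complete_card2 m).

(* W is the vertex set and F the edge set of the subgraph, which need not be
   induced. *)
Definition is_subgraph (G : sgraph) (W : {set G}) (F : {set {set G}}) : Prop :=
  F \subset edges G /\ (forall e, e \in F -> e \subset W).

Definition is_copy (H G : sgraph) (W : {set G}) (F : {set {set G}}) : Prop :=
  is_subgraph W F /\
  exists f : H -> G,
    [/\ injective f, f @: [set: H] = W &
        [set f @: e | e : {set H} in edges H] = F].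

(* Only the values of the labeling w on the edges of K_N matter: the edge set
   F of a copy is contained in the edge set of K_N. *)
Definition forces_zero_sum (H : sgraph) (N : nat) : Prop :=
  forall w : {set complete N} -> 'Z_3,
  exists (W : {set complete N}) (F : {set {set complete N}}),
    is_copy H W F /\ \sum_(e in F) w e = 0.

(* R(H, Z_3) = N. Only for 3 %| #|edges H| does such an N exist: otherwise a
   nonzero constant labeling has no zero-sum copy. *)
Definition is_zero_sum_ramsey (H : sgraph) (N : nat) : Prop :=
  forces_zero_sum H N /\ (forall M, forces_zero_sum H M -> (N <= M)%N).

(* Main.v *)
(* Upper bound: let w label K_N, N = 9k + 10, with total weight W and weighted
   degrees d, and suppose that no set of N - 3 vertices has total weight 0, so
   that all these totals have square 1. Summing the squares over all sets of
   N - 3 vertices gives 'C(N, 3) = 0 on the one hand; on the other hand each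
   ordered pair (e, f) of edges is counted 'C(N - #|e :|: f|, 3) = 2 times in
   Z_3, so the sum is 2 W^2, whence W = 0. Then the complement of a triangle abc
   has total weight c(ab) + c(ac) + c(bc), where c(uv) = w(uv) + d(u) + d(v),
   and N > 16 forces a triangle that is monochromatic for c.

   Lower bound: label uv by x_u x_v, where x takes the values 1, 1, 2, 2 on four
   vertices and 0 elsewhere. Then x has sum 0 and sum of squares 1, and the total
   weight after deletion of a and b is 1 + (x_a - x_b)^2, which is never 0; after
   deletion of a alone it is 1 + x_a^2. *)
Require Import Defs.
From mathcomp Require Import all_boot all_algebra.
From mathcomp Require Import zify ring.

Set Implicit Arguments.
Unset Strict Implicit.
Unset Printing Implicit Defensive.

Import GRing.Theory.
Local Open Scope ring_scope.

(** * Weights of complete subgraphs as sums over pairs *)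

Definition pairs (T : finType) (S : {set T}) : {set {set T}} :=
  [set e : {set T} | e \subset S & #|e| == 2%N].

Lemma pairs_imset (T U : finType) (f : T -> U) : injective f ->
  [set f @: e | e : {set T} in pairs setT] = pairs (f @: setT).
Proof.
move=> injf; apply/setP=> e; apply/imsetP/idP => [[e0 e0P ->]|].
  move: e0P; rewrite !inE => /andP[_ e0_2].
  by rewrite imsetS ?subsetT // card_imset.
rewrite inE => /andP[e_im e2].
have ee : e = f @: (f @^-1: e).
  apply/setP=> y; apply/idP/imsetP => [ye|[x]]; last by rewrite inE => ? ->.
  have /imsetP[x _ yx] := subsetP e_im y ye.
  by exists x => //; rewrite inE -yx.
by exists (f @^-1: e) => //; rewrite inE subsetT -(card_imset _ injf) -ee.
Qed.

(** A pair inside [v |: S] either avoids [v] or is [[set v; u]] for exactly one [u] in [S]; this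
    allows induction on the vertex set. *)
Lemma sum_pairsU1 (V : nmodType) (T : finType) (F : {set T} -> V)
    (v : T) (S : {set T}) : v \notin S ->
  \sum_(e in pairs (v |: S)) F e
  = \sum_(e in pairs S) F e + \sum_(u in S) F [set v; u].
Proof.
move=> vS.
have inj : {in S &, injective (fun u => [set v; u])}.
  move=> a b aS bS /= /setP/(_ a); rewrite !inE eqxx orbT.
  by case: eqP => [av|_ /esym/eqP //]; rewrite av (negPf vS) in aS.
rewrite -(big_imset (fun e => F e) inj) -bigU /=; last first.
  rewrite -setI_eq0; apply/eqP/setP=> e.
  rewrite in_set0 in_setI; apply/negbTE/negP.
  case/andP; rewrite inE => /andP[eS _] /imsetP[u _ eu].
  by move: vS; rewrite (subsetP eS) // eu !inE eqxx.
apply: eq_bigl => e; rewrite [in RHS]inE /=.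
apply/idP/orP => [|[|/imsetP[u uS ->]]].
- rewrite !inE => /andP[eS e2]; have [ve|ve] := boolP (v \in e); last first.
    by left; rewrite e2 andbT -(setU1K vS) subsetD1 eS.
  right; move: e2; rewrite (cardsD1 v) ve => /cards1P[u eu].
  have: u \in e :\ v by rewrite eu set11.
  rewrite !inE => /andP[uv ue]; apply/imsetP; exists u.
    by have := subsetP eS u ue; rewrite !inE (negPf uv).
  by rewrite -eu setD1K.
- by rewrite !inE => /andP[eS ->]; rewrite (subset_trans eS) ?subsetUr.
- have vu : v != u by apply: contraNneq vS => ->.
  by rewrite !inE cards2 subUset !sub1set !inE eqxx uS orbT vu.
Qed.

(** A copy of a complete graph carries every pair of its vertices as an edge, so it is determined by
    its vertex set. *)
Lemma forces_zero_sum_complete (n N : nat) :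
  forces_zero_sum (complete n) N <->
  forall w : {set 'I_N} -> 'Z_3,
    exists2 S : {set 'I_N}, #|S| = n & \sum_(e in pairs S) w e = 0.
Proof.
have edgesE m : edges (complete m) = pairs [set: 'I_m].
  by apply/setP=> e; rewrite !inE subsetT.
split=> forc w.
  have [W [F [[_ [f [injf fW fF]]] sum0]]] := forc w.
  exists W; first by rewrite -fW card_imset // cardsT card_ord.
  by rewrite -fW -pairs_imset // -(edgesE n) fF.
have [S Sn sum0] := forc w; exists S, (pairs S); split => //; split.
  split; last by move=> e; rewrite inE => /andP[].
  by rewrite edgesE; apply/subsetP=> e; rewrite !inE subsetT => /andP[].
pose f (i : 'I_n) : 'I_N := enum_val (cast_ord (esym Sn) i).
have injf : injective f by move=> i j /enum_val_inj/cast_ord_inj.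
have fS : f @: [set: 'I_n] = S.
  apply/eqP; rewrite eqEcard card_imset // cardsT card_ord Sn leqnn andbT.
  by apply/subsetP=> _ /imsetP[i _ ->]; apply: enum_valP.
by exists f; split=> //; rewrite edgesE pairs_imset // fS.
Qed.

Lemma Z3_case (P : 'Z_3 -> Prop) : P 0 -> P 1 -> P 2 -> forall x, P x.
Proof.
move=> P0 P1 P2 [[|[|[|//]]] lt].
- by rewrite (_ : Ordinal lt = 0) //; apply: val_inj.
- by rewrite (_ : Ordinal lt = 1) //; apply: val_inj.
- by rewrite (_ : Ordinal lt = 2) //; apply: val_inj.
Qed.

Lemma Z3_3 : 3 = 0 :> 'Z_3. Proof. exact: val_inj. Qed.

(* Since 2 = - 1 in Z_3, this is [2 e_2 = p_1 ^ 2 - p_2]. *)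
Lemma sum_pairs_prod (T : finType) (x : T -> 'Z_3) (S : {set T}) :
  \sum_(e in pairs S) \prod_(i in e) x i
  = \sum_(i in S) x i ^+ 2 - (\sum_(i in S) x i) ^+ 2.
Proof.
move Sn: #|S| => n; elim: n S Sn => [|n IHn] S Sn.
  have -> : pairs S = set0.
    apply/setP=> e; rewrite (cards0_eq Sn) !inE subset0.
    by case: eqP => // ->; rewrite cards0.
  by rewrite (cards0_eq Sn) !big_set0 expr0n subr0.
have [v vS] : exists v, v \in S by apply/card_gt0P; rewrite Sn.
have vD : v \notin S :\ v by rewrite !inE eqxx.
have Dn : #|S :\ v| = n by move: Sn; rewrite (cardsD1 v) vS add1n => -[].
rewrite -(setD1K vS) sum_pairsU1 // !big_setU1 //= IHn //.
rewrite [X in _ + X](eq_bigr (fun u => x v * x u)) => [|u uD]; last first.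
  rewrite big_setU1 ?big_set1 // inE.
  by apply: contraNneq vD => {1}->.
rewrite -mulr_sumr; set p := \sum_(i in _) x i; set q := \sum_(i in _) _.
apply/eqP; rewrite -subr_eq0.
rewrite (_ : _ - _ = 3 * (x v * p)); first by rewrite Z3_3 mul0r.
by ring.
Qed.

(** * Upper bound: monochromatic triangles and averaging over deleted triples *)

(* The values are 1, 2, 5, 16, the last one giving R(3, 3, 3) <= 17. *)
Fixpoint ramsey_bound (r : nat) : nat :=
  if r is r'.+1 then (r * ramsey_bound r').+1 else 1.

(** By pigeonhole some colour [k] joins [v] to more than [ramsey_bound r] vertices. Either a pair of
    colour [k] among them closes a triangle, or they use only the colours of [K :\ k]. *)
Lemma mono_triangle (T C : finType) (c : T -> T -> C) (K : {set C})
    (A : {set T}) :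
  {in A &, forall u v, u != v -> c u v \in K} ->
  (ramsey_bound #|K| < #|A|)%N ->
  exists u v t, [/\ uniq [:: u; v; t], c u v = c u t & c v t = c u t].
Proof.
move Kr: #|K| => r; elim: r K Kr A => [|r IHr] K Kr A cK.
  move=> /card_gt1P[u [v [uA vA uv]]].
  by have := cK u v uA vA uv; rewrite (cards0_eq Kr) inE.
move=> ltA; have [v vA] : exists v, v \in A by apply/card_gt0P; lia.
pose B k := [set u in A :\ v | c v u == k].
have cardB : (#|A| = 1 + \sum_(k in K) #|B k|)%N.
  rewrite (cardsD1 v) vA -sum1_card (partition_big (c v) (mem K)) /=.
    by congr (1 + _)%N; apply: eq_bigr => k _; rewrite -sum1_card;
       apply: eq_bigl => u; rewrite [in RHS]inE.
  by move=> u; rewrite !inE => /andP[uv uA]; rewrite cK // eq_sym.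
have [k kK ltB] : exists2 k, k \in K & (ramsey_bound r < #|B k|)%N.
  apply/exists_inP; apply: contraLR ltA; rewrite negb_exists_in -leqNgt cardB.
  move=> /forall_inP leB; rewrite /= ltnS -Kr -sum_nat_const.
  by apply: leq_sum => k kK; rewrite leqNgt leB.
have [/exists_inP[u uB /exists_inP[t tB /andP[ut /eqP cut]]]|noB] :=
  boolP [exists u in B k, exists t in B k, (u != t) && (c u t == k)].
  move: uB tB; rewrite !inE => /andP[/andP[uv uA] /eqP cu].
  move=> /andP[/andP[tv tA] /eqP ct].
  exists v, u, t; rewrite /= !inE negb_or eq_sym uv eq_sym tv ut.
  by rewrite cu ct cut.
apply: (IHr (K :\ k)) ltB.
  by move: Kr; rewrite (cardsD1 k) kK add1n => -[].
move=> u t uB tB ut; rewrite !inE; apply/andP; split.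
  apply: contra noB => cut; apply/exists_inP; exists u => //.
  by apply/exists_inP; exists t => //; rewrite ut.
move: uB tB; rewrite !inE => /andP[/andP[_ uA] _] /andP[/andP[_ tA] _].
exact: cK.
Qed.


(** Inclusion-exclusion: the three weighted degrees count each side of the triangle twice. *)
Lemma sum_pairsC3 (R : comPzRingType) (T : finType) (w : {set T} -> R)
    (d := fun a => \sum_(u | u != a) w [set a; u]) (a b c : T) :
  uniq [:: a; b; c] ->
  \sum_(e in pairs (~: [set a; b; c])) w e
  = \sum_(e in pairs setT) w e - (d a + d b + d c)
    + (w [set a; b] + w [set a; c] + w [set b; c]).
Proof.
rewrite /= !inE negb_or andbT => /andP[/andP[ab ac] bc].
set S := ~: _.
have cS : c \notin S by rewrite !inE eqxx orbT.
have bS : b \notin c |: S by rewrite !inE eqxx (negPf bc) orbT.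
have aS : a \notin b |: (c |: S) by rewrite !inE eqxx (negPf ab) (negPf ac).
have -> : [set: T] = a |: (b |: (c |: S)).
  by apply/setP=> u; rewrite !inE; do 3 case: eqP.
have dE x y z : x != y -> x != z -> y != z -> S = ~: [set x; y; z] ->
    d x = w [set x; y] + w [set x; z] + \sum_(u in S) w [set x; u].
  move=> xy xz yz ->; rewrite /d (bigD1 y) 1?eq_sym //= (bigD1 z) /=.
    rewrite addrA; congr (_ + _); apply: eq_bigl => u.
    by rewrite !inE !negb_or.
  by rewrite [z == x]eq_sym xz eq_sym.
have bS' : b \notin S by apply: contra bS => bS; rewrite inE bS orbT.
rewrite !sum_pairsU1 // !big_setU1 //= (dE a b c) //.
rewrite (dE b a c) //; first rewrite (dE c a b) //.
- by rewrite [[set b; a]]setUC [[set c; a]]setUC [[set c; b]]setUC; ring.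
- by rewrite eq_sym.
- by rewrite eq_sym.
- by rewrite /S [X in ~: X = _]setUC setUA.
- by rewrite eq_sym.
- by congr (~: (_ :|: _)); rewrite setUC.
Qed.

(** The denominator 6 of the binomial costs one factor 3, so a congruence modulo 9 of the numerators
    gives one modulo 3 of the binomials. *)
Lemma natr_bin3 (k s : nat) : 'C(9 * k + s.+2, 3)%:R = 'C(s.+2, 3)%:R :> 'Z_3.
Proof.
rewrite -Zp_nat_mod // -[RHS]Zp_nat_mod //; congr (_%:R).
have bin3 n : ('C(n.+2, 3) * 6 = n.+2 * n.+1 * n)%N.
  by rewrite (bin_ffact n.+2 3) !ffactSS ffactn1 mulnA.
have := bin3 (9 * k + s)%N; have := bin3 s; rewrite -!addnS.
set C := 'C(_, _); set C' := 'C(_, _) => eqC eqC'.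
suff : exists Q, ((9 * k + s.+2) * (9 * k + s.+1) * (9 * k + s)
                  = s.+2 * s.+1 * s + 9 * Q)%N by case=> Q; lia.
(* The terms containing [k] in the expanded product, divided by 9. *)
exists (k * (3 * s * s + 6 * s + 2 + 27 * k * s + 27 * k + 81 * k * k))%N.
by lia.
Qed.

Lemma sum_pairs_sqr (T : finType) (w : {set T} -> 'Z_3) (k : nat) :
  #|T| = (9 * k + 10)%N ->
  \sum_(A : {set T} | #|A| == 3%N) (\sum_(e in pairs (~: A)) w e) ^+ 2
  = 2 * (\sum_(e in pairs setT) w e) ^+ 2.
Proof.
move=> cardT.
have countE e f : e \in pairs setT -> f \in pairs setT ->
  #|[set A : {set T} | A \subset ~: (e :|: f) & #|A| == 3%N]|%:R = 2 :> 'Z_3.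
  rewrite !inE !subsetT /= => /eqP e2 /eqP f2.
  rewrite cards_draws cardsCs setCK cardT cardsU e2 f2.
  have le2 : (#|e :&: f| <= 2)%N by rewrite -e2 subset_leq_card ?subsetIl.
  have -> : (9 * k + 10 - (2 + 2 - #|e :&: f|) = 9 * k + (4 + #|e :&: f|).+2)%N.
    by lia.
  (* The binomials of 6, 7 and 8 over 3 are 20, 35 and 56, all equal to 2 modulo 3. *)
  by rewrite natr_bin3; case: #|_| le2 => [|[|[|//]]] _; apply: val_inj.
transitivity (\sum_(A : {set T} | #|A| == 3%N)
    \sum_(e in pairs setT | e \subset ~: A)
    \sum_(f in pairs setT | f \subset ~: A) w e * w f).
  apply: eq_bigr => A _.
  have -> : \sum_(e in pairs (~: A)) w e
          = \sum_(e in pairs setT | e \subset ~: A) w e.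
    by apply: eq_bigl => e; rewrite !inE subsetT andbC.
  rewrite expr2 mulr_suml; apply: eq_bigr => e _; exact: mulr_sumr.
rewrite (exchange_big_dep (mem (pairs setT))) /=; last by move=> A e _ /andP[].
rewrite expr2 mulr_suml mulr_sumr; apply: eq_bigr => e eP.
rewrite (exchange_big_dep (mem (pairs setT))) /=; last by move=> A f _ /andP[].
rewrite !mulr_sumr; apply: eq_bigr => f fP.
rewrite sumr_const -(countE e f) // mulr_natl; congr (_ *+ _).
apply: eq_card => A; rewrite [in RHS]inE subsetC subUset [in LHS]unfold_in /=.
by rewrite eP fP /= ![_ \subset ~: A]subsetC -andbA andbC.
Qed.

Lemma zero_sum_three_avoiding (T : finType) (w : {set T} -> 'Z_3) (k : nat) :
  (0 < k)%N -> #|T| = (9 * k + 10)%N ->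
  exists2 A : {set T}, #|A| = 3%N & \sum_(e in pairs (~: A)) w e = 0.
Proof.
move=> k_gt0 cardT.
have [/existsP[A /andP[/eqP A3 /eqP wA]]|] := boolP
  [exists A : {set T}, (#|A| == 3%N) && (\sum_(e in pairs (~: A)) w e == 0)].
  by exists A.
rewrite negb_exists => /forallP nz.
have sqr1 (z : 'Z_3) : z != 0 -> z ^+ 2 = 1.
  by elim/Z3_case: z => // _; apply: val_inj.
have W0 : \sum_(e in pairs setT) w e = 0.
  have := sum_pairs_sqr w cardT.
  rewrite (eq_bigr (fun=> 1)) => [|A A3]; last first.
    by apply: sqr1; have := nz A; rewrite A3.
  rewrite sumr_const -(cardsE (fun A : {set T} => #|A| == 3%N)) card_draws.
  (* The binomial of 10 over 3 is 120, a multiple of 3. *)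
  rewrite cardT (natr_bin3 k 8) (_ : 'C(10, 3)%:R = 0); last exact: val_inj.
  by elim/Z3_case: (\sum_(e in _) _).
pose d a := \sum_(u | u != a) w [set a; u].
pose c u v := w [set u; v] + d u + d v.
have [||u [v [t [uvt cuv cvt]]]] := @mono_triangle T 'Z_3 c setT setT.
- by move=> *; rewrite inE.
(* For three colours the bound is 16, and [0 < k] gives at least 19 vertices. *)
- rewrite !cardsT cardT (_ : #|_| = 3%N) ?card_ord //=; lia.
exists [set u; v; t].
  move: uvt; rewrite /= !inE negb_or andbT => /andP[/andP[uv ut] vt].
  by rewrite -setUA cardsU1 cards2 !inE negb_or uv ut vt.
rewrite sum_pairsC3 // W0 -/(d u) -/(d v) -/(d t).
(* Each degree occurs in two of the three values of [c], and 2 is -1 modulo 3. *)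
have -> : 0 - (d u + d v + d t) + (w [set u; v] + w [set u; t] + w [set v; t])
  = c u v + c u t + c v t - 3 * (d u + d v + d t) by rewrite /c; ring.
rewrite cuv cvt Z3_3 mul0r subr0 (_ : _ + _ = 3 * c u t); last by ring.
by rewrite Z3_3 mul0r.
Qed.

(** * Lower bound: a product labeling *)

Lemma not_forces_zero_sum_complete (n M : nat) :
  (4 <= n)%N -> (M <= n + 2)%N -> ~ forces_zero_sum (complete n) M.
Proof.
move=> n4 Mn /forces_zero_sum_complete forc.
(* Taking [y] on all natural numbers lets sums over ['I_M] be split at index 4. *)
pose y i : 'Z_3 := if (i < 2)%N then 1 else if (i < 4)%N then 2 else 0.
pose x (i : 'I_M) := y i.
have [S Sn] := forc (fun e => \prod_(i in e) x i).
rewrite sum_pairs_prod => sum0.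
have M4 : (4 <= M)%N.
  by rewrite (leq_trans n4) // -Sn -[leqRHS]card_ord max_card.
have sum_x (g : 'Z_3 -> 'Z_3) : g 0 = 0 ->
    \sum_i g (x i) = g 1 + g 1 + g 2 + g 2.
  move=> g0; rewrite -(big_mkord xpredT (fun i => g (y i))).
  rewrite (big_cat_nat _ (n := 4)) //= [X in _ + X]big1_seq => [|i].
    by rewrite unlock /= !addrA !addr0.
  rewrite mem_index_iota => /andP[_ /andP[i4 _]].
  by rewrite /y !ifN //; lia.
have splitS (g : 'Z_3 -> 'Z_3) :
    \sum_(i in S) g (x i) = \sum_i g (x i) - \sum_(i in ~: S) g (x i).
  rewrite (bigID (mem S) xpredT) /=.
  rewrite [X in _ - X](_ : _ = \sum_(i | i \notin S) g (x i)).
    by rewrite addrK.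
  by apply: eq_bigl => i; rewrite inE.
have cardC : (#|~: S| <= 2)%N by rewrite cardsCs setCK card_ord Sn; lia.
move: sum0.
rewrite (splitS id) (splitS (fun z => z ^+ 2)) (sum_x id) //.
rewrite (sum_x (fun z => z ^+ 2)) ?expr0n //.
have : (#|~: S| == 0) || (#|~: S| == 1) || (#|~: S| == 2).
  by case: #|_| cardC => [|[|[|]]].
(* At most two vertices lie outside [S]. In each case the weight is 1 plus a square, and -1 is not a
   square modulo 3. *)
case/orP => [/orP[/eqP/cards0_eq|/cards1P[a]]|/cards2P[a [b [ab]]]] ->.
- by rewrite !big_set0.
- by rewrite !big_set1; elim/Z3_case: (x a).
- rewrite !big_setU1 ?inE //= !big_set1.
  by elim/Z3_case: (x a); elim/Z3_case: (x b).
Qed.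

Theorem corollary1p3 (k : nat) (hk : (1 <= k)%N) :
  is_zero_sum_ramsey (complete (9 * k + 7)%N) (9 * k + 10)%N.
Proof.
split=> [|M forcM].
  apply/forces_zero_sum_complete => w.
  have [A A3 wA] := zero_sum_three_avoiding w hk (card_ord _).
  by exists (~: A); rewrite // cardsCs setCK card_ord A3; lia.
by rewrite leqNgt; apply/negP => ltM;
   apply: (not_forces_zero_sum_complete _ _ forcM); lia.
Qed.
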